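(* Let $m>0$ and $d\ge 0$ be integers with $m>d$. Then the subset of all $\mathrm{ad}$-surjective graded nilpotent Lie algebras belonging to $\mathrm{GLNA}(m,m+d)$ is generic in $\mathrm{GLNA}(m,m+d)$.
   Context: Lie algebras are real and finite-dimensional. A graded Lie algebra $\mathfrak m=\mathfrak m_{-1}\oplus\mathfrak m_{-2}$ (with $[\mathfrak m_{-1},\mathfrak m_{-1}]\subset\mathfrak m_{-2}$ and $\mathfrak m_{-2}$ central) is fundamental if it is generated by $\mathfrak m_{-1}$. It is $\mathrm{ad}$-surjective if there is $X\in\mathfrak m_{-1}$ such that $\mathrm{ad}X:\mathfrak m_{-1}\to\mathfrak m_{-2}$, $Y\mapsto [X,Y]$, is surjective (this holds trivially if $\mathfrak m_{-2}=0$). $\mathrm{GLNA}(m,m+d)$ denotes the set of all fundamental graded nilpotent Lie algebras $\mathfrak m=\mathfrak m_{-1}\oplus\mathfrak m_{-2}$ of step not greater than $2$ with $\dim\mathfrak m_{-1}=m$ and $\dim\mathfrak m_{-2}=d$. Such an algebra is encoded by the surjective map $\mathcal L:\bigwedge^2\mathfrak m_{-1}\to\mathfrak m_{-2}$, $\mathcal L(X,Y)=[X,Y]$, or equivalently by the $d$-dimensional image of the injective dual map $\mathcal L^*:(\mathfrak m_{-2})^*\to\bigwedge^2(\mathfrak m_{-1})^*$, $\mathcal L^*(p)(X,Y)=p([X,Y])$. In this way $\mathrm{GLNA}(m,m+d)$, up to isomorphism, is identified with the Grassmannian of $d$-dimensional subspaces of the space of skew-symmetric bilinear forms on an $m$-dimensional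 vector space, modulo the natural action of the general linear group. ''Generic'' means that the corresponding subset of this Grassmannian is a non-empty Zariski open subset. *)

(* Defs.v *)
From mathcomp Require Import all_boot all_order all_algebra.
From mathcomp Require Import reals.
From mathcomp Require Import mpoly.

Set Implicit Arguments.
Unset Strict Implicit.
Unset Printing Implicit Defensive.

Import GRing.Theory.
Local Open Scope ring_scope.

(* The bracket is stored as the linear map ad : g -> End(g), so that           *)
(* [x, y] = ad x y and bilinearity holds by typing; gl_m1 and gl_m2 are the    *)
(* components of degrees -1 and -2.                                            *)
Record gradedLie (R : fieldType) := GradedLie {
  gl_space :> vectType R;
  gl_ad : 'Hom(gl_space, 'End(gl_space));
  gl_m1 : {vspace gl_space};
  gl_m2 : {vspace gl_space};
  gl_alt : forall x, gl_ad x x = 0;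
  gl_jacobi : forall x y z,
    gl_ad x (gl_ad y z) + gl_ad y (gl_ad z x) + gl_ad z (gl_ad x y) = 0;
  gl_full : (gl_m1 + gl_m2)%VS = fullv;
  gl_direct : (gl_m1 :&: gl_m2)%VS = 0%VS;
  gl_bracket11 : forall x y, x \in gl_m1 -> y \in gl_m1 -> gl_ad x y \in gl_m2;
  gl_central2 : forall x y, x \in gl_m2 -> gl_ad x y = 0
}.

Definition fundamental (R : fieldType) (g : gradedLie R) : Prop :=
  forall h : {vspace g}, (gl_m1 g <= h)%VS ->
    (forall x y, x \in h -> y \in h -> gl_ad g x y \in h) ->
    h = fullv.

Definition ad_surjective (R : fieldType) (g : gradedLie R) : Prop :=
  exists2 X : g, X \in gl_m1 g & (gl_ad g X @: gl_m1 g)%VS = gl_m2 g.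

(* GLNA(m, m + d) *)
Definition GLNA (R : fieldType) (m d : nat) (g : gradedLie R) : Prop :=
  [/\ fundamental g, \dim (gl_m1 g) = m & \dim (gl_m2 g) = d].

Definition grassmannian (R : fieldType) (E : vectType R) (d : nat) :=
  {W : {vspace E} | \dim W == d}.

(* Increasing multi-indices t_0 < ... < t_(d-1) < N, i.e. the standard basis   *)
(* of the d-th exterior power of an N-dimensional space.                       *)
Definition plucker_index (N d : nat) : {set d.-tuple 'I_N} :=
  [set t : d.-tuple 'I_N | sorted ltn [seq val i | i <- t]].

(* Coordinates of b_0 /\ ... /\ b_(d-1). The basis of E used here is           *)
(* arbitrary: another one changes the coordinates by an invertible linear map, *)
(* hence does not affect [zariski_closed].                                     *)
Definition plucker (R : fieldType) (E : vectType R) (d : nat) (b : d.-tuple E)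
    (k : 'I_#|plucker_index (\dim {:E}) d|) : R :=
  \det (\matrix_(i < d, j < d)
          coord (vbasis {:E}) (tnth (enum_val k) j) (tnth b i)).

(* The Zariski topology of the Grassmannian as a projective variety. Changing  *)
(* the basis b of W rescales its Plucker vector, so for homogeneous f the      *)
(* vanishing condition depends on W only.                                      *)
Definition zariski_closed (R : fieldType) (E : vectType R) (d : nat)
    (Z : grassmannian E d -> Prop) : Prop :=
  exists S : {mpoly R[#|plucker_index (\dim {:E}) d|]} -> Prop,
    (forall f, S f -> exists k : nat, f \is k.-homog) /\
    (forall W, Z W <->
       forall f, S f -> forall b : d.-tuple E, basis_of (sval W) b ->
         f.@[plucker b] = 0).

Definition zariski_open (R : fieldType) (E : vectType R) (d : nat)
    (U : grassmannian E d -> Prop) : Prop :=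
  zariski_closed (fun W => ~ U W).

(* Skew-symmetric bilinear forms on R^m, as Gram matrices. *)
Definition skew_forms (R : fieldType) (m : nat) : {vspace 'M[R]_m} :=
  lker (\1%VF + linfun (@trmx R m m)).

Lemma skew_formsP (R : fieldType) (m : nat) (A : 'M[R]_m) :
  reflect (A^T = - A) (A \in skew_forms R m).
Proof.
rewrite memv_ker lfun_simp id_lfunE lfunE /= addrC addr_eq0; exact: eqP.
Qed.

Definition form_of (R : fieldType) (m : nat) (A : 'M[R]_m) (u v : 'rV[R]_m) : R :=
  (u *m A *m v^T) 0 0.

(* Under some linear identification phi of R^m with m_(-1), W is the image of  *)
(* L^* : (m_(-2))^* -> /\^2 (m_(-1))^*, L^*(p)(X, Y) = p([X, Y]). The          *)
(* projection vsproj only retypes [X, Y], which already lies in m_(-2).        *)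
Definition encoded_by (R : fieldType) (m d : nat) (g : gradedLie R)
    (W : grassmannian (subvs_of (skew_forms R m)) d) : Prop :=
  exists phi : 'Hom('rV[R]_m, g),
    [/\ lker phi = 0%VS, limg phi = gl_m1 g &
     forall A : subvs_of (skew_forms R m), A \in sval W <->
       exists p : 'Hom(subvs_of (gl_m2 g), R^o), forall u v : 'rV[R]_m,
         form_of (vsval A) u v = p (vsproj (gl_m2 g) (gl_ad g (phi u) (phi v)))].

(* A point W of the Grassmannian corresponds to the isomorphism class of the   *)
(* algebras g with [encoded_by g W]; U is the set of points whose class meets  *)
(* P.                                                                          *)
Definition generic_in_GLNA (R : fieldType) (m d : nat)
    (P : gradedLie R -> Prop) : Prop :=
  let U (W : grassmannian (subvs_of (skew_forms R m)) d) :=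
    exists g : gradedLie R, [/\ GLNA m d g, P g & encoded_by g W] in
  (exists W, U W) /\ zariski_open U.

(* Main.v *)
(* The class of W contains an ad-surjective algebra iff some x in R^m makes the
   contraction A |-> A(x, .) injective on W: surjectivity of ad X is dual to
   injectivity of L^*(p) |-> L^*(p)(X, .), and conversely the two-step algebra on
   R^m x R^d whose bracket is given by a basis of W is ad-surjective at x, hence
   fundamental. For a basis (b_i) of W, injectivity at x means that some d x d
   minor of the matrix with rows b_i(x, .) is nonzero, and by Cauchy-Binet such a
   minor is a linear form in the Plucker coordinates of W. So the locus is open;
   it contains the span of e_0^* /\ e_i^* for i = 1, ..., d < m, with x = e_0. *)
Require Import Defs.
From HB Require Import structures.
From mathcomp Require Import all_boot all_order all_algebra.
From mathcomp Require Import reals.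
From mathcomp Require Import perm mpoly.

Set Implicit Arguments.
Unset Strict Implicit.
Unset Printing Implicit Defensive.

Import GRing.Theory Num.Theory.
Local Open Scope ring_scope.

(** * Linear forms in the Plucker coordinates *)

Section PluckerLinear.
Variables (R : fieldType) (E : vectType R) (d : nat).

(** Degree one is recorded because [zariski_closed] admits only homogeneous equations. *)
Definition plucker_linear (F : d.-tuple E -> R) : Prop :=
  exists2 f : {mpoly R[#|plucker_index (\dim {:E}) d|]},
    f \is 1.-homog & forall b, f.@[plucker b] = F b.

Lemma eq_plucker_linear (F G : d.-tuple E -> R) :
  F =1 G -> plucker_linear F -> plucker_linear G.
Proof. by move=> FG [f f1 fF]; exists f => // b; rewrite fF FG. Qed.

Lemma plucker_linear0 : plucker_linear (fun=> 0).
Proof. by exists 0; [exact: dhomog0 | move=> b; rewrite meval0]. Qed.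

Lemma plucker_linearZ c (F : d.-tuple E -> R) :
  plucker_linear F -> plucker_linear (fun b => c * F b).
Proof.
move=> [f f1 fF]; exists (c *: f); first exact: dhomogZ.
by move=> b; rewrite mevalZ fF.
Qed.

Lemma plucker_linear_sum (I : finType) (F : I -> d.-tuple E -> R) :
  (forall i, plucker_linear (F i)) -> plucker_linear (fun b => \sum_i F i b).
Proof.
move=> Flin; elim: (index_enum I) => [|i s [g g1 gF]].
  apply: eq_plucker_linear plucker_linear0 => b; by rewrite big_nil.
have [f f1 fF] := Flin i; exists (f + g); first exact: dhomogD.
by move=> b; rewrite big_cons mevalD fF gF.
Qed.

Let coords (b : d.-tuple E) : 'M[R]_(d, \dim {:E}) :=
  \matrix_(i, k) coord (vbasis {:E}) k (tnth b i).

(** Only increasing column choices are Plucker coordinates: a repeated column makes the minor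
    vanish, and otherwise sorting the columns costs the sign of a permutation. *)
Lemma plucker_linear_minor (c : 'I_d -> 'I_(\dim {:E})) :
  plucker_linear (fun b => \det (colsub c (coords b))).
Proof.
have [/injectiveP c_inj|c_ninj] := boolP (injectiveb c); last first.
  have /injectivePn[i [j ij cij]] := c_ninj.
  apply: eq_plucker_linear plucker_linear0 => b; rewrite -det_tr.
  by rewrite (determinant_alternate ij) // => k; rewrite !mxE cij.
set leI : rel 'I_(\dim {:E}) := fun i j => (i <= j)%N.
set s := sort leI [tuple c i | i < d].
have s_perm : perm_eq s [tuple c i | i < d] by rewrite perm_sort.
have s_size : size s == d by rewrite (perm_size s_perm) size_tuple.
set t := Tuple s_size.
have s_uniq : uniq s.
  rewrite (perm_uniq s_perm) map_inj_uniq ?enum_uniq //.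
have t_in : t \in plucker_index (\dim {:E}) d.
  rewrite inE ltn_sorted_uniq_leq map_inj_uniq ?s_uniq //=; last exact: val_inj.
  by rewrite sorted_map; apply: sort_sorted => i j; exact: leq_total.
have /tuple_permP[p tE] : perm_eq [tuple c i | i < d] t by rewrite perm_sym.
have cE i : c i = tnth t (p i).
  by move/val_inj: tE => /(congr1 (fun u => tnth u i)); rewrite !tnth_mktuple.
exists ((-1) ^+ p *: 'X_(enum_rank_in t_in t)).
  by apply: dhomogZ; rewrite dhomogX /= mdeg1.
move=> b; rewrite mevalZ mevalXU /plucker enum_rankK_in //.
rewrite -odd_permV -det_perm mulrC -det_mulmx -col_permE.
by congr (determinant _); apply/matrixP => i j; rewrite !mxE cE.
Qed.

(* Cauchy-Binet expansion; only the existence of the coefficients matters. *)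
Lemma plucker_linear_det (l : 'I_d -> {scalar E}) :
  plucker_linear (fun b => \det (\matrix_(i, j) l j (tnth b i))).
Proof.
set e := vbasis {:E}.
(* Expanding each [l j] in the basis [e] produces all maps [c], not only the increasing ones;
   [plucker_linear_minor] covers every one of them. *)
apply: (@eq_plucker_linear (fun b => \sum_(c : {ffun 'I_d -> 'I_(\dim {:E})})
    (\prod_j l j e`_(c j)) * \det (colsub c (coords b)))); last first.
  by apply: plucker_linear_sum => c; apply/plucker_linearZ/plucker_linear_minor.
(* Transposing first makes the Leibniz product run over columns, so that factor [j] involves the
   single functional [l j]. *)
move=> b; rewrite -[RHS]det_tr [RHS]/determinant.
under [RHS]eq_bigr => s _.
  under eq_bigr => j _.
    rewrite !mxE (coord_vbasis (memvf (tnth b (s j)))) linear_sum /=.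
    under eq_bigr do rewrite linearZ /=.
    over.
  rewrite bigA_distr_bigA mulr_sumr; over.
rewrite exchange_big; apply: eq_bigr => c _ /=.
rewrite -det_tr mulr_sumr; apply: eq_bigr => s _.
rewrite big_split /= mulrC -mulrA; congr (_ * (_ * _)).
by apply: eq_bigr => j _; rewrite !mxE.
Qed.
End PluckerLinear.

(** * Full row rank and injectivity of the contraction *)

Lemma row_free_minorP (F : fieldType) (d m : nat) (M : 'M[F]_(d, m)) :
  row_free M <-> exists c : 'I_d -> 'I_m, \det (colsub c M) != 0.
Proof.
split=> [Mfree | [c detc]].
  have Mfull : row_full M^T by rewrite /row_full mxrank_tr.
  exists (fullrankfun Mfull).
  rewrite -[X in colsub _ X]trmxK -trmx_mxsub det_tr -unitfE -unitmxE.
  exact: fullrowsub_unit.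
apply: inj_row_free => v vM0.
have c_unit : colsub c M \in unitmx by rewrite unitmxE unitfE.
apply: (can_inj (mulmxK c_unit)); rewrite mul0mx mulmx_colsub vM0.
by apply/rowP => j; rewrite !mxE.
Qed.

(** The row [x *m vsval A] represents the linear form A(x, .). *)
Definition injective_at (F : fieldType) (m : nat)
    (W : {vspace subvs_of (skew_forms F m)}) (x : 'rV[F]_m) : Prop :=
  {in W, forall A, x *m vsval A = 0 -> A = 0}.

Definition contraction (F : fieldType) (m d : nat)
    (b : d.-tuple (subvs_of (skew_forms F m))) (x : 'rV[F]_m) : 'M[F]_(d, m) :=
  \matrix_i (x *m vsval (tnth b i)).

Lemma mul_contraction (F : fieldType) (m d : nat)
    (b : d.-tuple (subvs_of (skew_forms F m))) (x : 'rV[F]_m) (v : 'rV[F]_d) :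
  v *m contraction b x = x *m vsval (\sum_i v 0 i *: tnth b i).
Proof.
rewrite mulmx_sum_row linear_sum /= mulmx_sumr; apply: eq_bigr => i _.
by rewrite rowK linearZ /= scalemxAr.
Qed.

(** A basis identifies row vectors with elements of [W], and by [mul_contraction] a row vector kills
    the matrix exactly when x contracts the corresponding form to zero. *)
Lemma injective_at_row_free (F : fieldType) (m d : nat)
    (W : {vspace subvs_of (skew_forms F m)})
    (b : d.-tuple (subvs_of (skew_forms F m))) (x : 'rV[F]_m) :
  basis_of W b -> injective_at W x <-> row_free (contraction b x).
Proof.
move=> bW; have bfree := basis_free bW; split=> [inj | bx].
  apply: inj_row_free => v; rewrite mul_contraction => /inj sum0.
  apply/rowP => i; rewrite mxE.
  move/freeP: bfree => /(_ (fun i => v 0 i)); apply.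
  under eq_bigr do rewrite -tnth_nth.
  apply: sum0; apply: rpred_sum => j _; apply/rpredZ/(basis_mem bW).
  exact: mem_tnth.
move=> A AW xA; rewrite (coord_basis bW AW).
suff v0 : \row_i coord b i A = 0.
  by rewrite big1 // => i _; move/rowP/(_ i): v0; rewrite !mxE => ->; rewrite scale0r.
apply: (row_free_inj bx); rewrite mul0mx mul_contraction.
suff -> : \sum_i (\row_i coord b i A) 0 i *: tnth b i = A by [].
rewrite [RHS](coord_basis bW AW); apply: eq_bigr => i _.
by rewrite mxE (tnth_nth 0).
Qed.

(** * Bilinear forms and their Gram matrices *)

Section FormOf.
Variables (F : fieldType) (m : nat).
Implicit Types (A : 'M[F]_m) (u v : 'rV[F]_m).

Lemma form_ofZ c A u v : form_of (c *: A) u v = c * form_of A u v.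
Proof. by rewrite /form_of -scalemxAr -scalemxAl mxE. Qed.

Lemma form_of_sum (I : finType) (A : I -> 'M[F]_m) u v :
  form_of (\sum_i A i) u v = \sum_i form_of (A i) u v.
Proof. by rewrite /form_of mulmx_sumr mulmx_suml summxE. Qed.

Lemma form_of_linearl A v : linear_for *%R (fun u => form_of A u v).
Proof. by move=> c u w; rewrite /form_of !mulmxDl -!scalemxAl !mxE. Qed.

Lemma form_of_linearr A u : linear_for *%R (form_of A u).
Proof. by move=> c v w; rewrite /form_of linearP /= mulmxDr -scalemxAr !mxE. Qed.

Lemma form_of_skew A u v : A^T = - A -> form_of A v u = - form_of A u v.
Proof.
move=> At; have vAu : (v *m A *m u^T)^T = - (u *m A *m v^T).
  by rewrite !trmx_mul At trmxK mulNmx mulmxN mulmxA.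
by move/matrixP/(_ 0 0): vAu; rewrite /form_of mxE => ->; rewrite mxE.
Qed.

Lemma form_of_ext A B : (forall u v, form_of A u v = form_of B u v) -> A = B.
Proof.
have E C i j : form_of C (delta_mx 0 i) (delta_mx 0 j) = C i j.
  by rewrite /form_of -rowE trmx_delta -colE !mxE.
by move=> AB; apply/matrixP => i j; rewrite -!E.
Qed.

End FormOf.

HB.instance Definition _ (F : fieldType) (m : nat) (A : 'M[F]_m) u :=
  GRing.isLinear.Build F 'rV[F]_m F *%R (form_of A u) (form_of_linearr A u).

(** * The two-step algebra on F^m x F^d defined by d skew forms *)

Section Model.
Variables (F : numFieldType) (m d : nat).
Variable b : d.-tuple (subvs_of (skew_forms F m)).

Let V : vectType F := ('rV[F]_m * 'rV[F]_d)%type.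

Definition forms_bracket (p q : V) : V :=
  (0, \row_i form_of (vsval (tnth b i)) p.1 q.1).

Lemma forms_bracket_linearr p : linear (forms_bracket p).
Proof.
move=> c q r; apply: injective_projections => /=; first by rewrite scaler0 addr0.
by apply/rowP => i; rewrite !mxE form_of_linearr.
Qed.
HB.instance Definition _ p :=
  GRing.isLinear.Build F V V *:%R (forms_bracket p) (forms_bracket_linearr p).

Definition forms_ad_fun (p : V) : 'End(V) := linfun (forms_bracket p).

Lemma forms_ad_linear : linear forms_ad_fun.
Proof.
move=> c p q; apply/lfunP => r; rewrite add_lfunE scale_lfunE !lfunE.
apply: injective_projections => /=; first by rewrite scaler0 addr0.
by apply/rowP => i; rewrite !mxE form_of_linearl.
Qed.
HB.instance Definition _ :=
  GRing.isLinear.Build F V 'End(V) *:%R forms_ad_fun forms_ad_linear.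

Definition forms_ad : 'Hom(V, 'End(V)) := linfun forms_ad_fun.

Lemma forms_adE p q : forms_ad p q = forms_bracket p q.
Proof. by rewrite !lfunE. Qed.

Definition incl1 (u : 'rV[F]_m) : V := (u, 0).
Definition incl2 (w : 'rV[F]_d) : V := (0, w).

Lemma incl1_linear : linear incl1.
Proof. by move=> c u v; apply: injective_projections; rewrite /= ?scaler0 ?addr0. Qed.
HB.instance Definition _ := GRing.isLinear.Build F _ V *:%R incl1 incl1_linear.

Lemma incl2_linear : linear incl2.
Proof. by move=> c u v; apply: injective_projections; rewrite /= ?scaler0 ?addr0. Qed.
HB.instance Definition _ := GRing.isLinear.Build F _ V *:%R incl2 incl2_linear.

Definition forms_m1 : {vspace V} := limg (linfun incl1).
Definition forms_m2 : {vspace V} := limg (linfun incl2).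

Lemma mem_forms_m1 p : (p \in forms_m1) = (p.2 == 0).
Proof.
apply/memv_imgP/eqP => [[u _ ->] | p20]; first by rewrite lfunE.
by exists p.1; rewrite ?memvf // lfunE /= /incl1 -p20; case: p {p20}.
Qed.

Lemma mem_forms_m2 p : (p \in forms_m2) = (p.1 == 0).
Proof.
apply/memv_imgP/eqP => [[u _ ->] | p10]; first by rewrite lfunE.
by exists p.2; rewrite ?memvf // lfunE /= /incl2 -p10; case: p {p10}.
Qed.

(** Skew-symmetry gives 2 A(u, u) = 0, and 2 is invertible in a [numFieldType]. *)
Lemma skew_form_alt (A : subvs_of (skew_forms F m)) u :
  form_of (vsval A) u u = 0.
Proof.
have /skew_formsP/(form_of_skew u u)/eqP := subvsP A.
by rewrite -subr_eq0 opprK -mulr2n mulrn_eq0 => /eqP.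
Qed.

Lemma forms_alt p : forms_ad p p = 0.
Proof.
rewrite forms_adE; congr (_, _); apply/rowP => i.
by rewrite !mxE skew_form_alt.
Qed.

Lemma forms_central p q : p \in forms_m2 -> forms_ad p q = 0.
Proof.
rewrite mem_forms_m2 => /eqP p10; rewrite forms_adE; congr (_, _).
by apply/rowP => i; rewrite !mxE p10 /form_of !mul0mx mxE.
Qed.

Lemma forms_ad_m2 p q : forms_ad p q \in forms_m2.
Proof. by rewrite mem_forms_m2 forms_adE. Qed.

Lemma forms_central_r p q : q \in forms_m2 -> forms_ad p q = 0.
Proof.
rewrite mem_forms_m2 => /eqP q10; rewrite forms_adE; congr (_, _).
by apply/rowP => i; rewrite !mxE q10 linear0.
Qed.

(** All three terms vanish, since a bracket lies in the central summand. *)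
Lemma forms_jacobi p q r :
  forms_ad p (forms_ad q r) + forms_ad q (forms_ad r p)
    + forms_ad r (forms_ad p q) = 0.
Proof. by rewrite !(forms_central_r _ (forms_ad_m2 _ _)) !addr0. Qed.

Lemma forms_full : (forms_m1 + forms_m2)%VS = fullv.
Proof.
apply/vspaceP => p; rewrite memvf; apply/memv_addP.
exists (p.1, 0); first by rewrite mem_forms_m1.
exists (0, p.2); first by rewrite mem_forms_m2.
by case: p => u w; congr (_, _); rewrite /= ?addr0 ?add0r.
Qed.

Lemma forms_direct : (forms_m1 :&: forms_m2)%VS = 0%VS.
Proof.
apply/vspaceP => p; rewrite memv_cap mem_forms_m1 mem_forms_m2 memv0.
by rewrite andbC; case: p.
Qed.

Definition forms_algebra : gradedLie F :=
  @GradedLie F V forms_ad forms_m1 forms_m2 forms_alt forms_jacobi forms_full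
    forms_direct (fun p q _ _ => forms_ad_m2 p q) forms_central.

End Model.

(** * The model algebra encodes [W] *)

Section ModelEncodes.
Variables (F : numFieldType) (m d : nat).
Variable W : grassmannian (subvs_of (skew_forms F m)) d.
Variable b : d.-tuple (subvs_of (skew_forms F m)).
Hypothesis bW : basis_of (sval W) b.

Let m2 := forms_m2 F m d.

Lemma forms_ad_incl1 u v :
  forms_ad b (incl1 d u) (incl1 d v) =
  incl2 m (\row_i form_of (vsval (tnth b i)) u v).
Proof. by rewrite forms_adE. Qed.

Definition snd_form (c : 'cV[F]_d) (y : subvs_of m2) : F^o := ((vsval y).2 *m c) 0 0.

Lemma snd_form_linear c : linear (snd_form c).
Proof. by move=> a y z; rewrite /snd_form linearP /= mulmxDl -scalemxAl !mxE. Qed.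
HB.instance Definition _ c :=
  GRing.isLinear.Build F (subvs_of m2) F^o *:%R (snd_form c) (snd_form_linear c).

(** L^* sends the i-th coordinate functional of F^d to b_i, so its image is the span of [b]. *)
Lemma forms_algebra_encoded : encoded_by (forms_algebra b) W.
Proof.
exists (linfun (@incl1 F m d)); split=> [|//|A].
  apply/eqP/lker0P => u v; rewrite !lfunE /= => uv.
  exact: (congr1 (fun p => p.1) uv).
split=> [AW | [p Ap]].
  exists (linfun (snd_form (\col_i coord b i A))) => u v.
  rewrite [in RHS]lfunE /= /snd_form vsprojK; last exact: forms_ad_m2.
  rewrite !(lfunE (@incl1 F m d)) forms_ad_incl1 /= {1}(coord_basis bW AW).
  rewrite linear_sum form_of_sum mxE; apply: eq_bigr => i _.
  by rewrite linearZ form_ofZ !mxE mulrC (tnth_nth 0).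
(* The values of [p] on the standard basis of m_(-2) are the coordinates of L^*(p) in [b]. *)
set a := fun i => p (vsproj m2 (incl2 m (delta_mx 0 i))).
suff -> : A = \sum_i a i *: tnth b i.
  by apply: rpred_sum => i _; apply/rpredZ/(basis_mem bW)/mem_tnth.
apply/val_inj/form_of_ext => u v; rewrite Ap !(lfunE (@incl1 F m d)) /=.
rewrite forms_ad_incl1 [X in incl2 m X]row_sum_delta !linear_sum form_of_sum /=.
by apply: eq_bigr => i _; rewrite !linearZ form_ofZ mxE mulrC.
Qed.

Lemma row_form_of_contraction x v :
  \row_i form_of (vsval (tnth b i)) x v = v *m (contraction b x)^T.
Proof.
apply/rowP => i; rewrite /form_of !mxE; apply: eq_bigr => j _.
by rewrite !mxE mulrC.
Qed.

(** On m_(-1), ad of (x, 0) is right multiplication by the transposed contraction matrix, which is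
    onto when the contraction matrix has rank d. *)
Lemma forms_algebra_ad_surjective x :
  row_free (contraction b x) -> ad_surjective (forms_algebra b).
Proof.
move=> bx; exists (incl1 d x); first by rewrite mem_forms_m1.
apply/vspaceP => y; apply/memv_imgP/idP => [[v _ ->] | ].
  exact: forms_ad_m2.
rewrite mem_forms_m2 => /eqP y10.
have full : row_full (contraction b x)^T by rewrite /row_full mxrank_tr.
exists (incl1 d (y.2 *m pinvmx (contraction b x)^T)); first by rewrite mem_forms_m1.
rewrite forms_ad_incl1 row_form_of_contraction mulmxKpV ?submx_full //.
by rewrite /incl2 -y10; case: (y).
Qed.

Lemma forms_algebra_dim :
  \dim (gl_m1 (forms_algebra b)) = m /\ \dim (gl_m2 (forms_algebra b)) = d.
Proof.
split; rewrite limg_dim_eq ?dimvf /dim /= ?mul1n //.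
  apply/eqP; rewrite capfv; apply/lker0P => u v; rewrite !lfunE /= => uv.
  exact: (congr1 (fun p => p.1) uv).
apply/eqP; rewrite capfv; apply/lker0P => u v; rewrite !lfunE /= => uv.
exact: (congr1 (fun p => p.2) uv).
Qed.
End ModelEncodes.

(** * The ad-surjective locus in the Grassmannian *)

Lemma grassmannian_basis (F : fieldType) (E : vectType F) (d : nat)
    (W : grassmannian E d) : exists b : d.-tuple E, basis_of (sval W) b.
Proof.
have /eqP dimW := svalP W; exists (tcast dimW (vbasis (sval W))).
by rewrite val_tcast vbasisP.
Qed.

(** A subalgebra containing m_(-1) also contains [X, m_(-1)] = m_(-2). *)
Lemma ad_surjective_fundamental (F : fieldType) (g : gradedLie F) :
  ad_surjective g -> fundamental g.
Proof.
move=> [X Xm1 adX] h m1h hP; apply/eqP; rewrite eqEsubv subvf /=.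
rewrite -gl_full subv_add m1h -adX; apply/subvP => _ /memv_imgP[Y Ym1 ->].
by apply: hP; apply: (subvP m1h).
Qed.

(** Every bracket [phi u, phi v] equals [phi x, phi w] for some w, so a form A = L^*(p) with A(x, .)
    = 0 satisfies A(u, v) = A(x, w) = 0. *)
Lemma encoded_ad_surjective (F : fieldType) (m d : nat) (g : gradedLie F)
    (W : grassmannian (subvs_of (skew_forms F m)) d) :
  encoded_by g W -> ad_surjective g -> exists x, injective_at (sval W) x.
Proof.
move=> [phi [_ phi1 phiW]] [X]; rewrite -{1}phi1 => /memv_imgP[x _ ->] adx.
exists x => A /phiW[p Ap] xA; apply/val_inj/form_of_ext => u v.
rewrite Ap linear0 /= [RHS]/form_of mulmx0 mul0mx mxE.
have : gl_ad g (phi u) (phi v) \in (gl_ad g (phi x) @: gl_m1 g)%VS.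
  by rewrite adx; apply: gl_bracket11; rewrite -phi1 memv_img ?memvf.
rewrite -phi1 => /memv_imgP[_ /memv_imgP[w _ ->] ->].
by rewrite -Ap /form_of xA mul0mx mxE.
Qed.

(** Replaces the quantification over algebras by a condition on [W] alone; the converse is witnessed
    by the model algebra of any basis. *)
Lemma ad_surjective_locusP (F : numFieldType) (m d : nat)
    (W : grassmannian (subvs_of (skew_forms F m)) d) :
  (exists g, [/\ GLNA m d g, ad_surjective g & encoded_by g W]) <->
  exists x, injective_at (sval W) x.
Proof.
split=> [[g [_ gsurj gW]] | [x Wx]]; first exact: encoded_ad_surjective gW gsurj.
have [b bW] := grassmannian_basis W.
have surj := forms_algebra_ad_surjective ((injective_at_row_free x bW).1 Wx).
exists (forms_algebra b); split=> //; last exact: forms_algebra_encoded.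
by have [dim1 dim2] := forms_algebra_dim b; split=> //; exact: ad_surjective_fundamental.
Qed.

(** A linear relation among the forms contracts to the same relation among the rows. *)
Lemma row_free_contraction_free (F : fieldType) (m d : nat)
    (b : d.-tuple (subvs_of (skew_forms F m))) (x : 'rV[F]_m) :
  row_free (contraction b x) -> free b.
Proof.
move=> bx; apply/freeP => k; under eq_bigr do rewrite -tnth_nth.
move=> sum0 i; suff /rowP/(_ i): \row_j k j = 0 by rewrite !mxE.
apply: (row_free_inj bx); rewrite mul0mx mul_contraction.
under eq_bigr do rewrite mxE.
by rewrite sum0 !linear0.
Qed.

(** * Non-emptiness of the locus *)

Lemma exists_injective_at (F : fieldType) (m d : nat) : (d < m)%N ->
  exists (W : grassmannian (subvs_of (skew_forms F m)) d) x, injective_at (sval W) x.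
Proof.
case: m => // m; rewrite ltnS => dm.
(* The indices 1, ..., d avoid the index 0 of the contracting vector; the strict bound on d makes
   room for them. *)
pose s (i : 'I_d) : 'I_m.+1 := lift ord0 (widen_ord dm i).
pose e i : 'M[F]_m.+1 := delta_mx 0 (s i) - delta_mx (s i) 0.
have e_skew i : e i \in skew_forms F m.+1.
  by apply/skew_formsP; rewrite /e linearB /= !trmx_delta opprB.
pose b := [tuple vsproj (skew_forms F m.+1) (e i) | i < d].
have bx : row_free (contraction b (delta_mx 0 0)).
  apply/row_free_minorP; exists s.
  (* Contracting [e i] with the basis vector of index 0 leaves the one of index [s i], so the
     columns chosen by [s] form the identity. *)
  suff -> : colsub s (contraction b (delta_mx 0 0)) = 1%:M by rewrite det1 oner_eq0.
  apply/matrixP => i j; rewrite !mxE (bigD1 0) //= big1 => [|k k0].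
    rewrite tnth_mktuple vsprojK // !mxE !eqxx mul1r addr0 /= subr0.
    by rewrite (inj_eq lift_inj) eq_sym -val_eqE.
  by rewrite mxE (negbTE k0) andbF mul0r.
have bfree := row_free_contraction_free bx.
have dimb : \dim <<b>>%VS == d by rewrite (eqP bfree) size_tuple.
exists (Sub <<b>>%VS dimb : grassmannian _ _), (delta_mx 0 0).
apply/(injective_at_row_free _ (b := b)) => //.
by rewrite /basis_of eqxx.
Qed.

(** * Openness of the locus *)

Definition contraction_entry (F : fieldType) (m : nat) (x : 'rV[F]_m) (j : 'I_m)
    (A : subvs_of (skew_forms F m)) : F := (x *m vsval A) 0 j.

Lemma contraction_entry_linear (F : fieldType) (m : nat) (x : 'rV[F]_m) j :
  linear_for *%R (contraction_entry x j).
Proof.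
by move=> a A B; rewrite /contraction_entry (linearP vsval) mulmxDr -scalemxAr !mxE.
Qed.
HB.instance Definition _ (F : fieldType) (m : nat) (x : 'rV[F]_m) j :=
  GRing.isLinear.Build F (subvs_of (skew_forms F m)) F *%R (contraction_entry x j)
    (contraction_entry_linear x j).

(** Column j of the minor is the functional [contraction_entry x (c j)] evaluated along the tuple,
    so [plucker_linear_det] applies. *)
Lemma plucker_linear_contraction (F : fieldType) (m d : nat) (x : 'rV[F]_m)
    (c : 'I_d -> 'I_m) :
  plucker_linear (fun b : d.-tuple (subvs_of (skew_forms F m)) =>
    \det (colsub c (contraction b x))).
Proof.
apply: eq_plucker_linear (plucker_linear_det (fun j => contraction_entry x (c j))) => b.
by congr (determinant _); apply/matrixP => i j; rewrite [LHS]mxE 2![RHS]mxE.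
Qed.

Theorem lemma2p12 (R : realType) (m d : nat) (hm : (0 < m)%N) (hd : (d < m)%N) :
  generic_in_GLNA m d (@ad_surjective R).
Proof.
split.
  have [W Wx] := @exists_injective_at R m d hd.
  by exists W; apply/ad_surjective_locusP.
(* Equations of the complement: linear forms representing the maximal minors of the contraction
   matrices, for all x at once. *)
exists (fun f => exists (x : 'rV[R]_m) (c : 'I_d -> 'I_m), f \is 1.-homog /\
  forall b, f.@[plucker b] = \det (colsub c (contraction b x))).
split=> [f [x [c [f1 _]]] | W]; first by exists 1%N.
rewrite ad_surjective_locusP; split=> [noX f [x [c [_ fE]]] b bW | vanish [x Wx]].
  (* A nonzero minor would make the contraction at x injective on [W]. *)
  rewrite fE; apply/eqP; apply: contra_notT noX => minor.
  exists x; apply/(injective_at_row_free x bW)/row_free_minorP.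
  by exists c.
(* Conversely, a good x gives a nonzero minor, which the vanishing of its linear form excludes. *)
have [b bW] := grassmannian_basis W.
have /row_free_minorP[c] := (injective_at_row_free x bW).1 Wx.
have [f f1 fE] := plucker_linear_contraction x c.
by rewrite -fE (vanish f) ?eqxx //; exists x, c.
Qed.
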